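(* Let $m(x)=e^{x^2/2}\int_x^{\infty}e^{-t^2/2}\,dt$ be the Mills ratio of the standard normal law. Then the function $x\mapsto m(\sqrt{x})/\sqrt{x}$ is a Stieltjes transform on $(0,\infty)$, and consequently it is strictly completely monotonic and strictly reciprocally concave on $(0,\infty)$. In particular, for all $x,y>0$ the following chain of inequalities holds: $$\sqrt{\frac{x+y}{2xy}}\;m\left(\sqrt{\frac{2xy}{x+y}}\right)\;\geq\;\frac{\sqrt{y}\,m(\sqrt{x})+\sqrt{x}\,m(\sqrt{y})}{2\sqrt{xy}}\;\geq\;\sqrt{\frac{2}{x+y}}\;m\left(\sqrt{\frac{x+y}{2}}\right)\;\geq\;\frac{\sqrt{x}\,m(\sqrt{x})+\sqrt{y}\,m(\sqrt{y})}{x+y}.$$ In each of these three inequalities equality holds if and only if $x=y$.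
   Context: The standard normal density is $\varphi(x)=\frac{1}{\sqrt{2\pi}}e^{-x^2/2}$, its reliability function is $\overline{\Phi}(x)=\int_x^\infty\varphi(t)\,dt$, and its Mills ratio is $m(x)=\overline{\Phi}(x)/\varphi(x)=e^{x^2/2}\int_x^{\infty}e^{-t^2/2}\,dt$. A function $g:(0,\infty)\to\mathbb{R}$ is a Stieltjes transform if it has the form $g(x)=\alpha+\int_0^\infty\frac{d\nu(t)}{x+t}$, where $\alpha\geq 0$ and $\nu$ is a nonnegative measure on $[0,\infty)$ such that the integral converges for all $x>0$. A function $f:(0,\infty)\to\mathbb{R}$ is completely monotonic if it has derivatives of all orders and $(-1)^nf^{(n)}(x)\geq 0$ for all $x>0$ and $n\in\{0,1,2,\dots\}$; it is strictly completely monotonic if all these inequalities are strict. A function $g:(0,\infty)\to\mathbb{R}$ is (strictly) reciprocally concave if $x\mapsto g(x)$ is (strictly) convex and $x\mapsto g(1/x)$ is (strictly) concave on $(0,\infty)$. *)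

(* Defs.v *)
From mathcomp Require Import all_boot all_order all_algebra.
From mathcomp Require Import all_classical all_reals all_analysis.

Set Implicit Arguments.
Unset Strict Implicit.
Unset Printing Implicit Defensive.

Import Order.TTheory GRing.Theory Num.Theory.
Import numFieldNormedType.Exports.

Local Open Scope classical_set_scope.
Local Open Scope ring_scope.

(* Functions on (0, +oo) are represented by total functions R -> R, of which
   the definitions below constrain only the values on (0, +oo). *)

Definition mills (R : realType) (x : R) : R :=
  expR (x ^+ 2 / 2) *
  \int[@lebesgue_measure R]_(t in `[x, +oo[) expR (- t ^+ 2 / 2).

(* A Borel measure on [0, +oo) is given by a Borel measure nu on R, of which
   only the restriction to [0, +oo) is used. Integrability is the finiteness
   of the integral, which makes the real-valued integral meaningful. *)
Definition Stieltjes_transform (R : realType) (g : R -> R) : Prop :=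
  exists (alpha : R) (nu : {measure set (measurableTypeR R) -> \bar R}),
    0 <= alpha /\
    forall x : R, 0 < x ->
      nu.-integrable `[0, +oo[ (fun t : R => ((x + t)^-1)%:E) /\
      g x = alpha + \int[nu]_(t in `[0, +oo[) (x + t)^-1.

(* Since (0, +oo) is open, derivability and iterated derivatives at x > 0
   do not depend on the values of f outside (0, +oo). *)
Definition strictly_completely_monotonic (R : realType) (f : R -> R) : Prop :=
  forall (n : nat) (x : R), 0 < x ->
    derivable (derive1n n f) x 1 /\ 0 < (-1) ^+ n * derive1n n f x.

Definition strictly_convex_on (R : realType) (D : set R) (f : R -> R) : Prop :=
  forall x y t : R, D x -> D y -> x != y -> 0 < t < 1 ->
    f (t * x + (1 - t) * y) < t * f x + (1 - t) * f y.

Definition strictly_concave_on (R : realType) (D : set R) (f : R -> R) : Prop :=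
  forall x y t : R, D x -> D y -> x != y -> 0 < t < 1 ->
    t * f x + (1 - t) * f y < f (t * x + (1 - t) * y).

Definition strictly_reciprocally_concave (R : realType) (g : R -> R) : Prop :=
  strictly_convex_on `]0, +oo[ g /\
  strictly_concave_on `]0, +oo[ (fun x => g x^-1).

(* Main.v *)
Require Import Defs.
From HB Require Import structures.
From mathcomp Require Import all_boot all_order all_algebra.
From mathcomp Require Import all_classical all_reals all_analysis.
From mathcomp Require Import measurable_realfun.
From mathcomp Require Import ring lra.
Import Order.TTheory GRing.Theory Num.Theory.
Import numFieldNormedType.Exports.
Local Open Scope classical_set_scope.
Local Open Scope ring_scope.

(** Let [N] be a standard normal variable, and [g x = m (sqrt x) / sqrt x].
    Everything follows from the probabilistic formula [g x = E [1 / (x + N^2)]],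
    which says that [g] is the Stieltjes transform of the law of [N^2], the
    chi-squared law with one degree of freedom, with [alpha = 0].

    The formula, in the form [m u / u = E [1 / (u^2 + N^2)]]
    ([integral_normal_inv_add_sqr]), comes from computing in two orders the
    double integral of [w * exp (- (1 + (s / u)^2) * w^2 / 2)] over [w >= u] and
    all real [s]. Integrating first in [s] is a Gaussian integral of standard
    deviation [u / w], whose value cancels the factor [w] and leaves the tail
    integral of [exp (- w^2 / 2)] that defines [m]. Integrating first in [w] is
    elementary, because the factor [w] is the derivative of the square up to a
    constant, and leaves the normal density divided by [u^2 + s^2], up to a
    factor that depends only on [u].

    For the Stieltjes transform of a measure that charges ]0, +oo[, all
    derivatives are obtained by differentiating the kernel [1 / (x + t)] under
    the integral sign ([derive1n_Stieltjes]), hence strict complete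
    monotonicity. Strict convexity of [g] and strict concavity of [g (1 / x)]
    are inherited from the kernel: both defects have explicit nonnegative closed
    forms that are positive for [t > 0]
    ([Stieltjes_strictly_reciprocally_concave]).

    The chain of inequalities uses only the strict reciprocal concavity. Its
    four terms are [g (2 x y / (x + y))], [(g x + g y) / 2], [g ((x + y) / 2)]
    and [(x g x + y g y) / (x + y)]. Put [h z = g (1 / z)]. The first inequality
    is concavity of [h] at the midpoint of [1 / x] and [1 / y], the second is
    convexity of [g] at the midpoint of [x] and [y], and the third is concavity
    of [h] at the same two points [1 / x] and [1 / y], now with weights
    [x / (x + y)] and [y / (x + y)], for which the barycentre is
    [2 / (x + y)]. *)

(** * Stieltjes transforms of measures charging the open half-line *)

(** If the integral vanished, [f] would vanish almost everywhere on [D], so [E]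
    would be negligible. *)
Lemma Rintegral_gt0 (d : measure_display) (T : measurableType d)
    (R : realType) (mu : {measure set T -> \bar R}) (D E : set T) (f : T -> R) :
    measurable D -> measurable E -> E `<=` D -> (0 < mu E)%E ->
    mu.-integrable D (EFin \o f) ->
    (forall x, D x -> 0 <= f x) -> (forall x, E x -> 0 < f x) ->
  0 < \int[mu]_(x in D) f x.
Proof.
move=> mD mE ED muE intf f0 fE.
rewrite lt_neqAle Rintegral_ge0// andbT eq_sym; apply/eqP => If0.
have fin_If := integrable_fin_num mD intf.
have : (\int[mu]_(x in D) `|(f x)%:E| = 0)%E.
  rewrite -[RHS](congr1 EFin If0) /Rintegral fineK//.
  by apply: eq_integral => x /[!inE] Dx /=; rewrite ger0_norm ?f0.
have mf := measurable_int _ intf.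
move/(ae_eq_integral_abs mu mD mf) => aef.
have : mu.-negligible E.
  apply: negligibleS aef => x Ex /= /(_ (ED _ Ex)) [] fx0.
  by have := fE _ Ex; rewrite fx0 ltxx.
by move/(negligibleP mu mE) => muE0; rewrite muE0 ltxx in muE.
Qed.

Lemma is_derive_shift_exprVn (R : realType) (n : nat) (x t : R) : 0 < x + t ->
  is_derive x 1 (fun y : R => (y + t) ^- n.+1) (- n.+1%:R * (x + t) ^- n.+2).
Proof.
move=> xt0.
have dD : is_derive x 1 (fun y : R => (y + t) ^+ n.+1)
    (n.+1%:R * (x + t) ^+ n).
  have -> : (fun y : R => (y + t) ^+ n.+1) = (id + cst t) ^+ n.+1.
    by apply/funext => y; rewrite fctE.
  by apply: is_derive_eq; rewrite fctE addr0 scaler1.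
apply: (@is_derive_eq _ _ _ _ _ _ _ _ (is_deriveV _ dD)).
  by rewrite expf_neq0// gt_eqF.
rewrite /GRing.scale/= -exprVn !exprVn.
rewrite !exprS.
by field; rewrite expf_neq0 ?gt_eqF.
Qed.

(** The higher powers of the kernel are dominated by the kernel itself, since
    [x + t] is bounded below by the fixed number [x > 0]. *)
Lemma integrable_exprVn_shift (R : realType)
    (nu : {measure set (measurableTypeR R) -> \bar R}) (n : nat) (x : R) :
    0 < x ->
    nu.-integrable `[0, +oo[ (fun t : R => ((x + t)^-1)%:E) ->
  nu.-integrable `[0, +oo[ (EFin \o (fun t : R => (x + t) ^- n.+1)).
Proof.
move=> x0 int1.
have int2 : nu.-integrable `[0, +oo[
    (fun t : R => (x ^- n)%:E * ((x + t)^-1)%:E)%E by exact: integrableZl.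
apply: le_integrable int2 => //.
  have /measurable_EFinP mk := measurable_int _ int1.
  rewrite (_ : (fun t => _) = fun t : R => (x + t)^-1 ^+ n.+1); last first.
    by apply/funext => t; rewrite exprVn.
  exact/measurable_EFinP/measurable_funX.
move=> t /=; rewrite in_itv/= andbT => t0.
have xt0 : 0 < x + t by rewrite ltr_pwDl.
rewrite lee_fin.
rewrite !ger0_norm ?mulr_ge0 ?invr_ge0 ?exprn_ge0 ?(ltW x0) ?(ltW xt0)//.
rewrite exprSr invfM ler_pM2r ?invr_gt0// lef_pV2 ?posrE ?exprn_gt0//.
by rewrite lerXn2r ?nnegrE ?(ltW x0) ?(ltW xt0)// lerDl.
Qed.

(** On the neighbourhood ]x / 2, 2 x[ of [x] the derivative of the integrand is
    largest at the left end [x / 2], and its value there is integrable: this is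
    the domination that allows differentiating under the integral sign. *)
Lemma is_derive_Rintegral_exprVn_shift (R : realType)
    (nu : {measure set (measurableTypeR R) -> \bar R}) (n : nat) (x : R) :
    0 < x ->
    (forall y : R, 0 < y ->
      nu.-integrable `[0, +oo[ (fun t : R => ((y + t)^-1)%:E)) ->
  is_derive x 1 (fun y : R => \int[nu]_(t in `[0, +oo[) (y + t) ^- n.+1)
    (- n.+1%:R * \int[nu]_(t in `[0, +oo[) (x + t) ^- n.+2).
Proof.
move=> x0 int1.
pose I : set R := `](x / 2), (2 * x)[%classic.
pose f (y t : R) : R := (y + t) ^- n.+1.
have Igt0 y : I y -> 0 < x / 2 < y.
  by rewrite /I/= in_itv/= => /andP[-> _]; rewrite divr_gt0.
have Ix : I x by rewrite /I/= in_itv/=; lra.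
have dfE y t : 0 < y + t ->
    partial1of2 f y t = - n.+1%:R * (y + t) ^- n.+2.
  move=> yt0; rewrite partial1of2E.
  exact: (@derive_val _ _ _ _ _ _ _ (is_derive_shift_exprVn _ n y t yt0)).
have df y t : I y -> `[0, +oo[%classic t -> 0 < x / 2 + t <= y + t.
  move=> /Igt0; rewrite /= in_itv/= andbT => /andP[x20 xy] t0.
  by rewrite lerD2r (ltW xy) ltr_pwDl.
(* the absolute value makes the bound nonnegative on the whole line *)
pose G (t : R) : R := n.+1%:R * `|(x / 2 + t) ^- n.+2|.
have intf y : I y -> nu.-integrable `[0, +oo[ (EFin \o f y).
  move=> /Igt0/andP[x20 xy]; have y0 := lt_trans x20 xy.
  exact/integrable_exprVn_shift/int1.
have derf y t : I y -> `[0, +oo[%classic t -> derivable (f^~ t) y 1.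
  move=> Iy /(df _ _ Iy)/andP[x20 xy]; have yt0 := lt_le_trans x20 xy.
  by have [] := is_derive_shift_exprVn _ n y t yt0.
have G0 t : 0 <= G t by rewrite mulr_ge0.
have intG : nu.-integrable `[0, +oo[ (EFin \o G).
  have x20 : 0 < x / 2 by rewrite divr_gt0.
  rewrite (_ : EFin \o G = fun t =>
    (n.+1%:R%:E * `|(x / 2 + t) ^- n.+2|%:E)%E)//.
  apply: integrableZl => //.
  apply: (@integrable_norm _ _ _ nu _ (fun t : R => (x / 2 + t) ^- n.+2)).
  exact/integrable_exprVn_shift/int1.
have GE y t : I y -> `[0, +oo[%classic t -> `|partial1of2 f y t| <= G t.
  move=> Iy /(df _ _ Iy)/andP[x20 xy]; have yt0 := lt_le_trans x20 xy.
  rewrite dfE// normrM normrN normr_nat /G ler_pM2l//.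
  rewrite !ger0_norm ?invr_ge0 ?exprn_ge0 ?(ltW x20) ?(ltW yt0)//.
  rewrite lef_pV2 ?posrE ?exprn_gt0//.
  by rewrite lerXn2r ?nnegrE ?(ltW x20) ?(ltW yt0).
have mD : measurable (`[0, +oo[%classic : set (measurableTypeR R)) by [].
split.
  exact: (@derivable_under_integral _ _ _ _ _ _ mD _ _ _ Ix intf derf
    _ G0 intG GE).
rewrite -derive1E.
rewrite (@differentiation_under_integral _ _ _ _ _ _ mD _ _ _ Ix intf derf
  _ G0 intG GE).
rewrite -RintegralZl//; last exact/integrable_exprVn_shift/int1.
apply: eq_Rintegral => t /[!inE] t0.
by rewrite dfE//; have /andP[] := df _ _ Ix t0; exact: lt_le_trans.
Qed.

(** Strictness depends on where the measure has mass, so the pair that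
    [Stieltjes_transform] hides behind an existential is a parameter here. *)
Definition Stieltjes_representation {R : realType} (g : R -> R) (alpha : R)
    (nu : {measure set (measurableTypeR R) -> \bar R}) : Prop :=
  forall x : R, 0 < x ->
    nu.-integrable `[0, +oo[ (fun t : R => ((x + t)^-1)%:E) /\
    g x = alpha + \int[nu]_(t in `[0, +oo[) (x + t)^-1.

Lemma derive1n_Stieltjes (R : realType) (g : R -> R) (alpha : R)
    (nu : {measure set (measurableTypeR R) -> \bar R}) :
    Stieltjes_representation g alpha nu ->
  forall (n : nat) (x : R), 0 < x ->
    derive1n n g x = (n == 0)%:R * alpha +
      (-1) ^+ n * n`!%:R * \int[nu]_(t in `[0, +oo[) (x + t) ^- n.+1.
Proof.
move=> gE; elim=> [|n IHn] x x0.
  by have [_] := gE _ x0; rewrite eqxx !mul1r.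
rewrite derive1nS derive1E.
pose h y := (n == 0)%:R * alpha +
      (-1) ^+ n * n`!%:R * \int[nu]_(t in `[0, +oo[) (y + t) ^- n.+1.
have -> : 'D_1 (derive1n n g) x = 'D_1 h x.
  apply: near_eq_derive; near=> y; apply: IHn.
  by near: y; exact: lt_nbhsr.
have int1 y : 0 < y ->
    nu.-integrable `[0, +oo[ (fun t : R => ((y + t)^-1)%:E).
  by move=> y0; have [] := gE _ y0.
have dI := is_derive_Rintegral_exprVn_shift _ nu n x x0 int1.
have dh : is_derive x 1 h ((-1) ^+ n * n`!%:R *
    (- n.+1%:R * \int[nu]_(t in `[0, +oo[) (x + t) ^- n.+2)).
  rewrite /h; set I := fun y : R => Rintegral _ _ _ in dI *.
  rewrite -[X in is_derive _ _ X _]/(cst ((n == 0)%:R * alpha) +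
    ((-1) ^+ n * n`!%:R) *: I).
  by apply: is_derive_eq; rewrite add0r.
rewrite (@derive_val _ _ _ _ _ _ _ dh) [_.+1 == _]/= mul0r add0r.
rewrite factS natrM exprS.
by ring.
Unshelve. all: by end_near. Qed.

Lemma Stieltjes_strictly_completely_monotonic (R : realType) (g : R -> R)
    (alpha : R) (nu : {measure set (measurableTypeR R) -> \bar R}) :
    0 <= alpha -> (0 < nu `]0%R, +oo[%classic)%E ->
    Stieltjes_representation g alpha nu ->
  strictly_completely_monotonic g.
Proof.
move=> alpha0 nu0 gE n x x0.
have int1 (y : R) : 0 < y ->
    nu.-integrable `[0, +oo[ (fun t : R => ((y + t)^-1)%:E).
  by move=> y0; have [] := gE _ y0.
have gnE := derive1n_Stieltjes _ _ _ _ gE.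
split.
  apply: (@near_eq_derivable _ _ _ (fun y => (n == 0)%:R * alpha +
      (-1) ^+ n * n`!%:R * \int[nu]_(t in `[0, +oo[) (y + t) ^- n.+1)).
    by near=> y; rewrite gnE//; near: y; exact: lt_nbhsr.
  have [dI _] := is_derive_Rintegral_exprVn_shift _ nu n x x0 int1.
  by apply: derivableD => //; exact: derivableZ.
rewrite gnE// mulrDr !mulrA -exprMn mulrNN mulr1 expr1n mul1r.
apply: ltr_wpDl.
  by case: n => [|n]; rewrite ?mulr0 ?mul0r// expr0 !mul1r.
rewrite mulr_gt0 ?ltr0n ?fact_gt0//.
apply: (@Rintegral_gt0 _ _ _ nu _ `]0, +oo[%classic) => //.
- by apply: subset_itvr; rewrite bnd_simp.
- exact/integrable_exprVn_shift/int1.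
- move=> t /=; rewrite in_itv/= andbT => t0.
  by rewrite invr_ge0 exprn_ge0// addr_ge0// ltW.
- move=> t /=; rewrite in_itv/= andbT => t0.
  by rewrite invr_gt0 exprn_gt0// addr_gt0.
Unshelve. all: by end_near. Qed.

Lemma invr_shift_convex_gap (R : realType) (a b t s z : R) :
    0 < a -> 0 < b -> 0 <= s -> a != b -> 0 < t < 1 ->
    z = t * a + (1 - t) * b ->
  0 < t * (a + s)^-1 + (1 - t) * (b + s)^-1 - (z + s)^-1.
Proof.
move=> a0 b0 s0 ab /andP[t0 t1] zE.
have as0 : 0 < a + s by rewrite ltr_pwDl.
have bs0 : 0 < b + s by rewrite ltr_pwDl.
have zs0 : 0 < z + s by rewrite zE; nra.
rewrite (_ : _ - _ =
    t * (1 - t) * (a - b) ^+ 2 / ((a + s) * (b + s) * (z + s))).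
  have ab2 : 0 < (a - b) ^+ 2 by rewrite exprn_even_gt0//= subr_eq0.
  apply: divr_gt0; last by rewrite !mulr_gt0.
  by apply: mulr_gt0 => //; rewrite mulr_gt0 ?subr_gt0.
rewrite zE in zs0 *.
by field; rewrite !gt_eqF.
Qed.

(** The gap is kept as an identity because it degenerates at [s = 0], where
    [x] maps to [(x^-1 + s)^-1 = x] is linear: strict concavity can only come
    from the part of the measure carried by ]0, +oo[. *)
Lemma invr_shift_concave_gap (R : realType) (a b t s z : R) :
    0 < a -> 0 < b -> 0 <= s -> 0 < t < 1 -> z = t * a + (1 - t) * b ->
  (z^-1 + s)^-1 - (t * (a^-1 + s)^-1 + (1 - t) * (b^-1 + s)^-1) =
  s * (t * (1 - t) * (a - b) ^+ 2 / ((1 + a * s) * (1 + b * s) * (1 + z * s))).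
Proof.
move=> a0 b0 s0 /andP[t0 t1] zE.
have inv_shift (c : R) : 0 < c -> (c^-1 + s)^-1 = c / (1 + c * s).
  move=> c0; have cs : 0 < 1 + c * s by rewrite ltr_pwDl// mulr_ge0// ltW.
  have cs' : 0 < c^-1 + s by rewrite ltr_pwDl ?invr_gt0.
  by field; rewrite !gt_eqF.
have z0 : 0 < z by rewrite zE; nra.
have as0 : 0 < 1 + a * s by rewrite ltr_pwDl// mulr_ge0// ltW.
have bs0 : 0 < 1 + b * s by rewrite ltr_pwDl// mulr_ge0// ltW.
have zs0 : 0 < 1 + z * s by rewrite ltr_pwDl// mulr_ge0// ltW.
rewrite !inv_shift// zE in zs0 *.
by field; rewrite !gt_eqF.
Qed.

Lemma Stieltjes_strictly_reciprocally_concave (R : realType) (g : R -> R)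
    (alpha : R) (nu : {measure set (measurableTypeR R) -> \bar R}) :
    (0 < nu `]0%R, +oo[%classic)%E -> Stieltjes_representation g alpha nu ->
  strictly_reciprocally_concave g.
Proof.
move=> nu0 gE.
have int1 (y : R) : 0 < y ->
    nu.-integrable `[0, +oo[ (EFin \o (fun t : R => (y + t)^-1)).
  by move=> y0; have [] := gE _ y0.
have mD : measurable (`[0, +oo[%classic : set (measurableTypeR R)) by [].
have intZ (r y : R) : 0 < y ->
    nu.-integrable `[0, +oo[ (EFin \o (fun t : R => r * (y + t)^-1)).
  by move=> y0; apply: (integrableZl mD r (int1 y y0)).
have intD (r q x y : R) : 0 < x -> 0 < y ->
    nu.-integrable `[0, +oo[
      (EFin \o (fun t : R => r * (x + t)^-1 + q * (y + t)^-1)).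
  by move=> x0 y0; apply: (integrableD mD (intZ r x x0) (intZ q y y0)).
have combE (t x y : R) : 0 < x -> 0 < y ->
    t * g x + (1 - t) * g y =
    alpha + \int[nu]_(s in `[0, +oo[) (t * (x + s)^-1 + (1 - t) * (y + s)^-1).
  move=> x0 y0; have [_ ->] := gE _ x0; have [_ ->] := gE _ y0.
  rewrite RintegralD//; [|exact: intZ..].
  by rewrite !RintegralZl//; [ring|exact: int1..].
have convgt0 (x y t : R) : 0 < x -> 0 < y -> 0 < t < 1 ->
    0 < t * x + (1 - t) * y.
  by move=> x0 y0 /andP[t0 t1]; nra.
split=> x y t; rewrite /= !in_itv/= !andbT => x0 y0 xy t01.
- have z0 := convgt0 _ _ _ x0 y0 t01.
  rewrite combE// (gE _ z0).2 ltrD2l -subr_gt0 -RintegralB//;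
    [|exact: intD|exact: int1].
  apply: (@Rintegral_gt0 _ _ _ nu _ `]0, +oo[%classic) => //.
  + by apply: subset_itvr; rewrite bnd_simp.
  + by apply: (integrableB mD (intD _ _ _ _ x0 y0) (int1 _ z0)).
  + move=> s /=; rewrite in_itv/= andbT => s0.
    by apply/ltW/invr_shift_convex_gap.
  + move=> s /=; rewrite in_itv/= andbT => s0.
    by apply: invr_shift_convex_gap => //; exact: ltW.
- have z0 := convgt0 _ _ _ x0 y0 t01.
  have [xi yi zi] : [/\ 0 < x^-1, 0 < y^-1 & 0 < (t * x + (1 - t) * y)^-1].
    by rewrite !invr_gt0.
  rewrite combE// (gE _ zi).2 ltrD2l -subr_gt0 -RintegralB//;
    [|exact: int1|exact: intD].
  have gap_gt0 (s : R) : 0 <= s ->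
      0 < t * (1 - t) * (x - y) ^+ 2 /
        ((1 + x * s) * (1 + y * s) * (1 + (t * x + (1 - t) * y) * s)).
    case/andP: t01 => t0 t1 s0.
    have D0 (c : R) : 0 < c -> 0 < 1 + c * s.
      by move=> c0; rewrite ltr_pwDl// mulr_ge0// ltW.
    have xy2 : 0 < (x - y) ^+ 2 by rewrite exprn_even_gt0//= subr_eq0.
    apply: divr_gt0; last by rewrite !mulr_gt0 ?D0// convgt0// t0.
    by apply: mulr_gt0 => //; rewrite mulr_gt0 ?subr_gt0.
  apply: (@Rintegral_gt0 _ _ _ nu _ `]0, +oo[%classic) => //.
  + by apply: subset_itvr; rewrite bnd_simp.
  + by apply: (integrableB mD (int1 _ zi) (intD _ _ _ _ xi yi)).
  + move=> s /=; rewrite in_itv/= andbT => s0.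
    rewrite (invr_shift_concave_gap _ x y t s _ x0 y0 s0 t01 erefl).
    by apply: mulr_ge0 => //; apply: ltW; exact: gap_gt0.
  + move=> s /=; rewrite in_itv/= andbT => s0.
    rewrite (invr_shift_concave_gap _ x y t s _ x0 y0 (ltW s0) t01 erefl).
    by apply: mulr_gt0 => //; apply: gap_gt0; exact: ltW.
Qed.

(** The outer two inequalities are both the concavity of [h z = g (1 / z)] at
    [1 / x] and [1 / y]: with equal weights the barycentre is the inverse of the
    harmonic mean, and with weights [x / (x + y)] and [y / (x + y)] it is the
    inverse of the arithmetic mean. *)
Lemma strictly_reciprocally_concave_chain (R : realType) (g : R -> R)
    (x y : R) :
    strictly_reciprocally_concave g -> 0 < x -> 0 < y -> x != y ->
  [/\ (g x + g y) / 2 < g (2 * x * y / (x + y)),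
      g ((x + y) / 2) < (g x + g y) / 2 &
      (x * g x + y * g y) / (x + y) < g ((x + y) / 2)].
Proof.
move=> [cvx ccv] x0 y0 xy.
have Ipos (c : R) : 0 < c -> (`]0, +oo[%classic : set R) c.
  by move=> c0; rewrite /= in_itv/= c0.
have xy0 : x + y != 0 by rewrite gt_eqF// addr_gt0.
have xyV : x^-1 != y^-1 by rewrite (inj_eq invr_inj).
have [xV yV] : 0 < x^-1 /\ 0 < y^-1 by rewrite !invr_gt0.
have x_neq0 := lt0r_neq0 x0. have y_neq0 := lt0r_neq0 y0.
have half : 0 < (2^-1 : R) < 1 by lra.
split.
- have := ccv _ _ _ (Ipos _ xV) (Ipos _ yV) xyV half.
  rewrite !invrK.
  have -> : (2^-1 * x^-1 + (1 - 2^-1) * y^-1)^-1 = 2 * x * y / (x + y).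
    by field; rewrite x_neq0 y_neq0 xy0.
  have -> : 2^-1 * g x + (1 - 2^-1) * g y = (g x + g y) / 2 by field.
  by [].
- have := cvx _ _ _ (Ipos _ x0) (Ipos _ y0) xy half.
  have -> : 2^-1 * x + (1 - 2^-1) * y = (x + y) / 2 by field.
  have -> : 2^-1 * g x + (1 - 2^-1) * g y = (g x + g y) / 2 by field.
  by [].
- have wt : 0 < x / (x + y) < 1.
    by rewrite divr_gt0 ?addr_gt0// ltr_pdivrMr ?addr_gt0// mul1r ltrDl.
  have := ccv _ _ _ (Ipos _ xV) (Ipos _ yV) xyV wt.
  rewrite !invrK.
  have -> : (x / (x + y) * x^-1 + (1 - x / (x + y)) * y^-1)^-1 = (x + y) / 2.
    rewrite -[RHS]invrK; congr _^-1.
    by field; rewrite x_neq0 y_neq0 xy0.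
  have -> : x / (x + y) * g x + (1 - x / (x + y)) * g y =
      (x * g x + y * g y) / (x + y) by field.
  by [].
Qed.

(** * The Mills ratio as a Gaussian expectation *)

(** The normal density is a Radon-Nikodym derivative of the normal law, by
    uniqueness of that derivative up to a null set. *)
Lemma integral_normal_prob (R : realType) (m s : R)
    (f : measurableTypeR R -> \bar R) :
    (normal_prob m s).-integrable [set: _] f ->
  (\int[normal_prob m s]_x f x =
   \int[@lebesgue_measure R]_x (f x * (normal_pdf m s x)%:E))%E.
Proof.
move=> intf; have mf := measurable_int _ intf.
have dom := @normal_prob_dominates R m s.
rewrite -(Radon_Nikodym_change_of_variables dom)//.
apply: ae_eq_integral => //.
- exact: emeasurable_funM.
- apply: emeasurable_funM => //=.
  by apply/measurableT_comp => //=; exact: measurable_normal_pdf.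
apply: ae_eqe_mul2l; rewrite Radon_NikodymE//=.
case: cid => /= h [h1 h2 h3].
apply: integral_ae_eq => //=.
- by apply/measurableT_comp => //=; exact: measurable_normal_pdf.
- by move=> E _ mE; rewrite -h3.
Qed.

Lemma integral_gauss_scale (R : realType) (c : R) : 0 < c ->
  (\int[@lebesgue_measure R]_s (expR (- (s / c) ^+ 2 / 2))%:E =
   (c * Num.sqrt (2 * pi))%:E)%E.
Proof.
move=> c0; have cn0 : c != 0 by rewrite gt_eqF.
have K : 0 < c * Num.sqrt (2 * pi) :> R.
  by rewrite mulr_gt0// sqrtr_gt0 mulr_gt0// pi_gt0.
have peakE : normal_peak c = (c * Num.sqrt (2 * pi))^-1.
  rewrite /normal_peak -mulrnAr -mulr_natl sqrtrM ?sqr_ge0//.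
  by rewrite sqrtr_sqr ger0_norm ?ltW.
under eq_integral => s _.
  rewrite (_ : expR _ = (c * Num.sqrt (2 * pi)) * normal_pdf 0 c s); last first.
    rewrite normal_pdfE// peakE mulrA divff ?gt_eqF// mul1r /normal_fun subr0.
    by congr expR; rewrite -mulr_natr; field.
  rewrite EFinM; over.
rewrite ge0_integralZl_EFin//; last 3 first.
- by move=> s _; rewrite lee_fin normal_pdf_ge0.
- by apply/measurableT_comp => //=; exact: measurable_normal_pdf.
- exact: ltW.
by rewrite integral_normal_pdf mule1.
Qed.

Lemma integral_id_expR_tail (R : realType) (k u : R) : 0 < k -> 0 < u ->
  (\int[@lebesgue_measure R]_(w in `[u, +oo[) (w * expR (- (k * w ^+ 2)))%:E =
   (expR (- (k * u ^+ 2)) / (2 * k))%:E)%E.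
Proof.
move=> k0 u0.
pose F (w : R) := - (2 * k)^-1 * expR (- (k * w ^+ 2)).
have dF (w : R) : is_derive w 1 F (w * expR (- (k * w ^+ 2))).
  have dq : is_derive w 1 (fun w : R => - (k * w ^+ 2)) (- (k * (2 * w))).
    rewrite [X in is_derive _ _ X _](_ : _ = (- k) *: (id ^+ 2)); last first.
      by apply/funext => v; rewrite !fctE /GRing.scale/= mulNr.
    by apply: is_derive_eq; rewrite /GRing.scale/= expr1 mulr1 mulNr.
  have de := is_derive1_comp (is_derive_expR _) dq.
  rewrite [F](_ : _ =
    (- (2 * k)^-1) *: (expR \o (fun w : R => - (k * w ^+ 2)))) //.
  by apply: is_derive_eq; rewrite /GRing.scale/=; field; rewrite gt_eqF.
have cF : continuous F.
  move=> w; apply: differentiable_continuous; apply/derivable1_diffP.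
  by have [] := dF w.
have cE : continuous (fun w : R => expR (- (k * w ^+ 2))).
  move=> w; apply: (@continuous_comp _ _ _ (fun w : R => - (k * w ^+ 2)) expR).
    by apply: cvgN; apply: cvgM; [exact: cvg_cst|exact: exprn_continuous].
  exact: continuous_expR.
rewrite (@ge0_continuous_FTC2y _ _ F u 0).
- by rewrite -EFinB /F; congr EFin; field; rewrite gt_eqF.
- move=> w uw; rewrite mulr_ge0 ?expR_ge0// (le_trans _ uw)//; exact: ltW.
- apply: continuous_subspaceT => w; apply: cvgM; [exact: cvg_id|exact: cE].
- rewrite -[0](mulr0 (- (2 * k)^-1)); apply: cvgM; first exact: cvg_cst.
  apply: (@cvg_comp _ _ _ (fun w : R => k * w ^+ 2)
    (fun w : R => expR (- w)) _ +oo%R); last exact: cvgr_expR.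
  by apply: gt0_cvgMry => //; exact: cvgr_expr2.
- by move=> w _; have [] := dF w.
- exact/cvg_at_right_filter/cF.
- by move=> w _; rewrite derive1E; exact: derive_val.
Qed.

Lemma integrable_normal_inv_add_sqr (R : realType) (a : R) : 0 < a ->
  (normal_prob 0 1).-integrable [set: measurableTypeR R]
    (fun s : R => ((a + s ^+ 2)^-1)%:E).
Proof.
move=> a0.
apply: (@measurable_bounded_integrable _ _ _ (normal_prob 0 1)
  (fun s : R => (a + s ^+ 2)^-1)) => //.
- by rewrite (le_lt_trans (probability_le1 _ _))// ltry.
- apply: continuous_measurable_fun => s; apply: cvgV.
    by rewrite gt_eqF// ltr_pwDl ?sqr_ge0.
  by apply: cvgD; [exact: cvg_cst|exact: exprn_continuous].
- exists a^-1; split; first exact: num_real.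
  move=> M aM s _; apply: le_trans (ltW aM).
  have as0 : 0 < a + s ^+ 2 by rewrite ltr_pwDl ?sqr_ge0.
  by rewrite ger0_norm ?invr_ge0 ?(ltW as0)// lef_pV2 ?posrE// lerDl sqr_ge0.
Qed.

(** Both sides are values of the same double integral, by Tonelli's theorem;
    the finiteness of the left side then forces that of the tail integral, and
    so identifies it with its real value in [mills]. *)
Lemma integral_normal_inv_add_sqr (R : realType) (u : R) : 0 < u ->
  (\int[normal_prob 0 1]_s ((u ^+ 2 + s ^+ 2)^-1)%:E = (mills u / u)%:E)%E.
Proof.
move=> u0; have u_neq0 : u != 0 by rewrite gt_eqF.
have u2 : 0 < u ^+ 2 by rewrite exprn_gt0.
have intN := integrable_normal_inv_add_sqr _ _ u2.
pose c : R := Num.sqrt (2 * pi).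
have c0 : 0 < c by rewrite sqrtr_gt0 mulr_gt0// pi_gt0.
pose k (s : R) := (1 + (s / u) ^+ 2) / 2.
have k0 s : 0 < k s by rewrite divr_gt0// ltr_pwDl ?sqr_ge0.
(* [w exp (- w^2 / 2)] times an unnormalized normal density in [s] of standard
   deviation [u / w], cut off at [w >= u] *)
pose H (p : measurableTypeR R * measurableTypeR R) : R :=
  p.1 * expR (- (k p.2 * p.1 ^+ 2)) * \1_`[u, +oo[%classic p.1.
have H0 p : (0 <= (H p)%:E)%E.
  rewrite lee_fin /H indicE.
  case: (boolP (p.1 \in _)) => [|_]; last by rewrite mulr0.
  rewrite mulr1 inE/= in_itv/= andbT => up; rewrite mulr_ge0 ?expR_ge0//.
  by rewrite (le_trans _ up)// ltW.
have mH : measurable_fun setT (fun p => (H p)%:E).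
  apply/measurableT_comp => //; apply: measurable_funM; last first.
    by apply: measurableT_comp => //; exact: measurable_indic.
  apply: measurable_funM => //; apply: measurableT_comp => //.
  apply: measurableT_comp => //.
  apply: measurable_funM; last exact: measurable_funX.
  apply: measurable_funM => //; apply: measurable_funD => //.
  apply: measurable_funX; exact: measurable_funM.
pose J :=
  (\int[@lebesgue_measure R]_(w in `[u, +oo[) (expR (- w ^+ 2 / 2))%:E)%E.
have IH1 :
    (\int[@lebesgue_measure R]_w \int[@lebesgue_measure R]_s (H (w, s))%:E =
     (u * c)%:E * J)%E.
  rewrite /J [in RHS]integral_mkcond -ge0_integralZl_EFin//; last 3 first.
  - by move=> w _; rewrite patchE; case: ifPn => // _; rewrite lee_fin expR_ge0.
  - apply/(measurable_restrictT _ _).1 => //; apply/measurableT_comp => //.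
    apply/measurable_funTS/measurableT_comp => //.
    by apply: measurable_funM => //; apply: measurableT_comp => //;
      exact: measurable_funX.
  - by rewrite mulr_ge0// ltW.
  apply: eq_integral => w _; rewrite patchE /H/= indicE.
  case: ifPn => [|_]; last first.
    by under eq_integral do rewrite mulr0; rewrite integral0 mule0.
  rewrite inE/= in_itv/= andbT => uw; have w0 := lt_le_trans u0 uw.
  have w_neq0 : w != 0 by rewrite gt_eqF.
  under eq_integral => s _.
    rewrite (_ : _ * _ * _ = (w * expR (- w ^+ 2 / 2)) *
        expR (- (s / (u / w)) ^+ 2 / 2)); last first.
      rewrite mulr1 -mulrA -expRD; congr (_ * expR _).
      by rewrite /k; field; rewrite u_neq0 w_neq0.
    rewrite EFinM; over.
  rewrite ge0_integralZl_EFin//; last 2 first.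
  - apply/measurableT_comp => //; apply: measurableT_comp => //.
    apply: measurable_funM => //; apply: measurableT_comp => //.
    by apply: measurable_funX; exact: measurable_funM.
  - by rewrite mulr_ge0 ?expR_ge0// ltW.
  rewrite integral_gauss_scale ?divr_gt0// -!EFinM; congr EFin.
  by rewrite -/c; field.
have IH2 :
    (\int[@lebesgue_measure R]_s \int[@lebesgue_measure R]_w (H (w, s))%:E =
     (u ^+ 2 * expR (- u ^+ 2 / 2) * c)%:E *
      \int[normal_prob 0 1]_s ((u ^+ 2 + s ^+ 2)^-1)%:E)%E.
  rewrite integral_normal_prob// -ge0_integralZl_EFin//; last 3 first.
  - move=> s _; rewrite mule_ge0 ?lee_fin ?normal_pdf_ge0//.
    by rewrite invr_ge0 addr_ge0 ?sqr_ge0.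
  - apply: emeasurable_funM; first exact: measurable_int intN.
    by apply/measurableT_comp => //; exact: measurable_normal_pdf.
  - by rewrite !mulr_ge0 ?expR_ge0// ?ltW.
  apply: eq_integral => s _.
  rewrite [LHS](_ : _ = \int[@lebesgue_measure R]_(w in `[u, +oo[)
      (w * expR (- (k s * w ^+ 2)))%:E)%E; last first.
    rewrite [in RHS]integral_mkcond; apply: eq_integral => w _.
    by rewrite /H/= patchE indicE; case: ifPn => _; rewrite ?mulr1 ?mulr0.
  rewrite integral_id_expR_tail//; rewrite -!EFinM; congr EFin.
  rewrite normal_pdfE ?oner_neq0// /normal_peak /normal_fun subr0 expr1n mul1r.
  rewrite -[pi *+ 2]mulr_natl -/c.
  have us : u ^+ 2 + s ^+ 2 != 0 by rewrite gt_eqF// ltr_pwDl ?sqr_ge0.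
  have -> : - (k s * u ^+ 2) = - u ^+ 2 / 2 + - s ^+ 2 / (1 *+ 2).
    by rewrite /k; field.
  by rewrite expRD /k; field; rewrite us u_neq0 gt_eqF.
have := fubini_tonelli (m1 := @lebesgue_measure R)
  (m2 := @lebesgue_measure R) _ mH H0.
rewrite IH1 IH2.
have finN := integrable_fin_num measurableT intN.
have : (0 <= J)%E by apply: integral_ge0 => w _; rewrite lee_fin expR_ge0.
rewrite /mills /Rintegral -/J.
rewrite -(fineK finN) -EFinM.
case: (J) => // [r|] _.
- case=> E; congr EFin.
  have K0 : 0 < u ^+ 2 * expR (- u ^+ 2 / 2) * c by rewrite !mulr_gt0 ?expR_gt0.
  apply: (mulfI (lt0r_neq0 K0)).
  rewrite -E mulNr expRN/=.
  have := lt0r_neq0 (expR_gt0 (u ^+ 2 / 2)); move: (expR _) => e e_neq0.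
  by field; rewrite u_neq0 e_neq0.
(* an infinite tail integral would make the finite expectation infinite *)
- by rewrite gt0_muley// lte_fin mulr_gt0.
Qed.

(** * The function m(sqrt x)/sqrt x and the chain of inequalities *)

Definition sqr_mfun {R : realType} (s : measurableTypeR R) :
    measurableTypeR R :=
  (s : R) ^+ 2.

Lemma measurable_sqr_mfun {R : realType} :
  measurable_fun [set: measurableTypeR R] (@sqr_mfun R).
Proof. exact: measurable_funX. Qed.

HB.instance Definition _ (R : realType) :=
  isMeasurableFun.Build _ _ _ _ (@sqr_mfun R) measurable_sqr_mfun.

Definition chi_square_law (R : realType) :
    {measure set (measurableTypeR R) -> \bar R} :=
  distribution (normal_prob 0 1) (@sqr_mfun R).

(** Single points are negligible for the normal law, so [N^2] is positive almost
    surely: this is the source of strictness in the results below. *)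
Lemma chi_square_law_itv_gt0 (R : realType) :
  (0 < chi_square_law R `]0%R, +oo[%classic)%E.
Proof.
have N0 : normal_prob 0 1 [set (0 : R)] = 0%E.
  apply: (null_content_dominatesP _ _).1 (normal_prob_dominates 0 1) _ _ _;
    [by []|exact: lebesgue_measure_set1].
rewrite /chi_square_law/= /distribution /pushforward.
rewrite [X in normal_prob _ _ X](_ : _ = ~` [set 0]); last first.
  apply/seteqP; split => s /=; rewrite in_itv/= andbT /sqr_mfun;
    by rewrite exprn_even_gt0//= => /eqP.
rewrite probability_setC//.
by rewrite [X in (1 - X)%E]N0 sube0 lte01.
Qed.

Lemma mills_sqrt_Stieltjes (R : realType) :
  Stieltjes_representation (fun x : R => mills (Num.sqrt x) / Num.sqrt x)
    0 (chi_square_law R).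
Proof.
move=> x x0.
have u0 : 0 < Num.sqrt x by rewrite sqrtr_gt0.
have uE : Num.sqrt x ^+ 2 = x by rewrite sqr_sqrtr// ltW.
have mk : measurable_fun (`[0, +oo[%classic : set (measurableTypeR R))
    (fun t : R => ((x + t)^-1)%:E).
  apply/measurableT_comp => //; apply: subspace_continuous_measurable_fun => //.
  apply: continuous_in_subspaceT => t /[!inE]/=; rewrite in_itv/= andbT => t0.
  apply: cvgV; first by rewrite gt_eqF// ltr_pwDl.
  by apply: cvgD; [exact: cvg_cst|exact: cvg_id].
have preim : @sqr_mfun R @^-1` `[0, +oo[%classic = setT.
  by apply/seteqP; split => // s _ /=; rewrite in_itv/= andbT sqr_ge0.
have IE : (\int[chi_square_law R]_(t in `[0%R, +oo[) ((x + t)^-1)%:E =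
    (mills (Num.sqrt x) / Num.sqrt x)%:E)%E.
  rewrite (ge0_integral_pushforward measurable_sqr_mfun (normal_prob 0 1))//.
    by rewrite preim -integral_normal_inv_add_sqr// uE.
  move=> t /[!inE]/=; rewrite in_itv/= andbT => t0.
  by rewrite lee_fin invr_ge0 addr_ge0// ltW.
split; last by rewrite /Rintegral IE add0r.
apply/integrableP; split => //.
under eq_integral => t /[!inE]/= t0.
  rewrite ger0_norm; last first.
    move: t0; rewrite in_itv/= andbT => t0.
    by rewrite invr_ge0 addr_ge0// ltW.
  over.
by rewrite IE ltry.
Qed.

Theorem theorem1 (R : realType) :
  [/\ Stieltjes_transform (fun x : R => mills (Num.sqrt x) / Num.sqrt x),
      strictly_completely_monotonic
        (fun x : R => mills (Num.sqrt x) / Num.sqrt x),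
      strictly_reciprocally_concave
        (fun x : R => mills (Num.sqrt x) / Num.sqrt x) &
      forall x y : R, 0 < x -> 0 < y ->
        let A := Num.sqrt ((x + y) / (2 * x * y)) *
                 mills (Num.sqrt (2 * x * y / (x + y))) in
        let B := (Num.sqrt y * mills (Num.sqrt x) +
                  Num.sqrt x * mills (Num.sqrt y)) /
                 (2 * Num.sqrt (x * y)) in
        let C := Num.sqrt (2 / (x + y)) *
                 mills (Num.sqrt ((x + y) / 2)) in
        let D := (Num.sqrt x * mills (Num.sqrt x) +
                  Num.sqrt y * mills (Num.sqrt y)) / (x + y) in
        [/\ A >= B, B >= C & C >= D] /\
        [/\ A = B <-> x = y, B = C <-> x = y & C = D <-> x = y]].
Proof.
have gE := mills_sqrt_Stieltjes R.
have nu0 := chi_square_law_itv_gt0 R.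
set g := (fun x : R => _) in gE *.
have ccv := Stieltjes_strictly_reciprocally_concave _ _ _ _ nu0 gE.
split => //.
- by exists 0, (chi_square_law R).
- exact: Stieltjes_strictly_completely_monotonic (lexx 0) nu0 gE.
move=> x y x0 y0 A B C D.
have xy0 : 0 < x + y by rewrite addr_gt0.
have sx0 : 0 < Num.sqrt x by rewrite sqrtr_gt0.
have sy0 : 0 < Num.sqrt y by rewrite sqrtr_gt0.
have AE : A = g (2 * x * y / (x + y)).
  by rewrite /A /g mulrC -sqrtrV ?invf_div// divr_ge0 ?mulr_ge0// ltW.
have CE : C = g ((x + y) / 2).
  by rewrite /C /g mulrC -sqrtrV ?invf_div// divr_ge0// ltW.
have BE : B = (g x + g y) / 2.
  rewrite /B /g sqrtrM ?ltW//; field.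
  by rewrite !gt_eqF.
have DE : D = (x * g x + y * g y) / (x + y).
  have mulg (z : R) : 0 < z -> z * g z = Num.sqrt z * mills (Num.sqrt z).
    move=> z0; have sz0 : Num.sqrt z != 0 by rewrite gt_eqF ?sqrtr_gt0.
    by rewrite /g -[X in X * _](sqr_sqrtr (ltW z0)); field.
  by rewrite !mulg.
rewrite AE BE CE DE.
have [<-|xy] := eqVneq x y.
  have xx : x + x != 0 by rewrite gt_eqF ?addr_gt0.
  have -> : 2 * x * x / (x + x) = x by field.
  have -> : (x + x) / 2 = x by field.
  have -> : (g x + g x) / 2 = g x by field.
  have -> : (x * g x + x * g x) / (x + x) = g x by field.
  by [].
have [BA CB DC] := strictly_reciprocally_concave_chain _ _ _ _ ccv x0 y0 xy.
split; first by split; exact: ltW.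
by split; split => [E|xyE]; move: BA CB DC xy; rewrite ?E ?xyE ?ltxx ?eqxx.
Qed.
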